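(* Let $L\ge 2$, $d\ge1$, and let $x_0,\dots,x_{L-1}\in\mathbb{R}^d$ be pairwise distinct templates of equal Euclidean norm. Let $n_0,\dots,n_{M-1}$ be i.i.d. $\mathcal{N}(0,I_{d\times d})$ and let $\hat{x}_0,\dots,\hat{x}_{L-1}$ be the output of either the hard-assignment or the soft-assignment algorithm. Then for every $0\le\ell\le L-1$ there exist real coefficients $\alpha_{\ell k}$, $k=0,\dots,L-1$, such that $\hat{x}_\ell\to\sum_{k=0}^{L-1}\alpha_{\ell k}x_k$ almost surely as $M\to\infty$.
   Context: Hard-assignment: $\hat{R}_i=\arg\max_\ell\langle n_i,x_\ell\rangle$, $\mathcal{A}_\ell=\{n_i:\hat{R}_i=\ell\}$, $\hat{x}_\ell=\frac{1}{|\mathcal{A}_\ell|}\sum_{n_i\in\mathcal{A}_\ell}n_i$. Soft-assignment: $p_i^{(\ell)}=\frac{\exp(\langle n_i,x_\ell\rangle)}{\sum_r\exp(\langle n_i,x_r\rangle)}$, $\hat{x}_\ell=\frac{\sum_ip_i^{(\ell)}n_i}{\sum_ip_i^{(\ell)}}$. *)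

(* Defs.v *)
From HB Require Import structures.
From mathcomp Require Import all_boot all_order all_algebra.
From mathcomp Require Import all_classical all_reals all_analysis.
From mathcomp Require Import normal_distribution.
Set Implicit Arguments. Unset Strict Implicit. Unset Printing Implicit Defensive.
Import Order.TTheory GRing.Theory Num.Theory.
Import numFieldNormedType.Exports.
Local Open Scope classical_set_scope.
Local Open Scope ring_scope.

Section defs.
Context {R : realType}.

Definition dotv (d : nat) (u v : 'rV[R]_d) : R := \sum_(j < d) u 0 j * v 0 j.
Definition enorm (d : nat) (u : 'rV[R]_d) : R := Num.sqrt (dotv u u).

Definition mutually_independent (dT : measure_display) (T : measurableType dT)
  (P : probability T R) (I : eqType) (X : I -> T -> R) : Prop :=
  forall (F : seq I) (B : I -> set R), uniq F ->
    (forall i, i \in F -> measurable (B i)) ->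
    P (\bigcap_(i in [set` F]) (X i @^-1` B i)) =
    (\prod_(i <- F) P (X i @^-1` B i))%E.

(* n : nat -> T -> R^d is an i.i.d. N(0, I_d) sequence: all coordinates
   (n i)_j, over all i and j, are measurable, mutually independent and
   standard normal; i.e. the vectors are i.i.d. with law N(0, I_d). *)
Definition iid_std_gaussian (dT : measure_display) (T : measurableType dT)
  (P : probability T R) (d : nat) (n : nat -> T -> 'rV[R]_d) : Prop :=
  [/\ (forall i (j : 'I_d), measurable_fun setT (fun w => n i w 0 j)),
      (forall i (j : 'I_d) (B : set R), measurable B ->
          P ((fun w => n i w 0 j) @^-1` B) = normal_prob 0 1 B) &
      mutually_independent P
        (fun ij : nat * 'I_d => fun w => n ij.1 w 0 ij.2)].

(* Hard assignment: sample u is assigned to template l iff l is the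
   (smallest-index) maximiser of <u, x_r> over r. *)
Definition hard_assigned (d L : nat) (x : 'I_L -> 'rV[R]_d) (u : 'rV[R]_d)
  (l : 'I_L) : bool :=
  [forall r : 'I_L, (dotv u (x r) <= dotv u (x l)) &&
                    ((r < l)%N ==> (dotv u (x r) < dotv u (x l)))].

(* Hard-assignment output from the first M samples: the average of the
   samples assigned to l (0 if no sample is assigned to l). *)
Definition hard_estimate (d L : nat) (x : 'I_L -> 'rV[R]_d)
  (n : nat -> 'rV[R]_d) (M : nat) (l : 'I_L) : 'rV[R]_d :=
  let c := \sum_(i < M | hard_assigned x (n i) l) (1 : R) in
  c^-1 *: \sum_(i < M | hard_assigned x (n i) l) n i.

Definition soft_weight (d L : nat) (x : 'I_L -> 'rV[R]_d) (u : 'rV[R]_d)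
  (l : 'I_L) : R :=
  expR (dotv u (x l)) / \sum_(r < L) expR (dotv u (x r)).

Definition soft_estimate (d L : nat) (x : 'I_L -> 'rV[R]_d)
  (n : nat -> 'rV[R]_d) (M : nat) (l : 'I_L) : 'rV[R]_d :=
  (\sum_(i < M) soft_weight x (n i) l)^-1 *:
     \sum_(i < M) soft_weight x (n i) l *: n i.

End defs.

(* Main.v *)
Require Import Defs.
From HB Require Import structures.
From mathcomp Require Import all_boot all_order all_algebra.
From mathcomp Require Import all_classical all_reals all_analysis.
From mathcomp Require Import measurable_realfun normal_distribution ring lra.
Import Order.TTheory GRing.Theory Num.Theory.
Import numFieldNormedType.Exports.
Local Open Scope classical_set_scope.
Local Open Scope ring_scope.

(** Both estimators are weighted means (sum_i W(n_i))^-1 sum_i W(n_i) n_i in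
    which the weight W(u) in [0, 1] depends on u only through the inner products
    <u, x_k>. By the strong law of large numbers such a mean converges almost
    surely to E[W(n_0) n_0] / E[W(n_0)], so it suffices that E[W(n_0) n_0] lies
    in the span of the x_k, i.e. that E[W(n_0) <n_0, v>] = 0 whenever v is
    orthogonal to every x_k. For such v, W is invariant under translation along
    v, and the Cameron-Martin formula gives
    E[W(n_0) exp(t <n_0, v>)] = exp(t^2 |v|^2 / 2) E[W(n_0)]. As
    1 + y <= exp y, this yields
    t E[W(n_0) <n_0, v>] <= exp(t^2 |v|^2 / 2) - 1, and t -> 0+ shows that the
    expectation is at most 0; replacing v by -v shows that it vanishes.
    The strong law is only needed for square integrable variables: positive and
    negative parts reduce it to nonnegative ones, for which the second moment
    bound gives convergence along M = k^2 and monotonicity of the partial sums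
    fills the gaps. *)

(** * Integration against a measure with a density *)

Section density.
Local Open Scope ereal_scope.
Context {d} {T : measurableType d} {R : realType}.
Variables (mu : {measure set T -> \bar R}) (f : T -> R).
Hypotheses (mf : measurable_fun setT f) (f0 : forall x, (0 <= f x)%R).

(** The hypotheses on [f] are arguments so that the measure structure below can be attached to the
    term [mdensity mf f0]. *)
Definition mdensity of measurable_fun setT f & (forall x, (0 <= f x)%R) :=
  fun A => \int[mu]_(x in A) (f x)%:E.

Let mdensity0 : mdensity mf f0 set0 = 0.
Proof. by rewrite /mdensity integral_set0. Qed.

Let mdensity_ge0 A : 0 <= mdensity mf f0 A.
Proof. by apply: integral_ge0 => x _; rewrite lee_fin. Qed.

Let mdensity_sigma_additive : semi_sigma_additive (mdensity mf f0).
Proof.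
move=> F mF tF mUF; rewrite /mdensity; apply: cvg_toP.
  apply: ereal_nondecreasing_is_cvgn => m n mn.
  by apply: lee_sum_nneg_natr => // k _ _; apply: integral_ge0 => x _; rewrite lee_fin.
rewrite ge0_integral_bigcup//= => [|x _]; last by rewrite lee_fin.
exact/measurable_EFinP/measurable_funTS.
Qed.

HB.instance Definition _ := isMeasure.Build _ _ _ (mdensity mf f0)
  mdensity0 mdensity_ge0 mdensity_sigma_additive.

Import HBNNSimple.

(** Leaving [nu] arbitrary, instead of fixing it to be [mdensity], makes the formula apply directly
    to [normal_prob], to restrictions and to push-forwards. It is checked on simple functions and
    passes to [g] by monotone convergence. *)
Lemma ge0_integral_density (nu : {measure set T -> \bar R}) (g : T -> \bar R) :
  (forall A, measurable A -> nu A = \int[mu]_(x in A) (f x)%:E) ->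
  measurable_fun setT g -> (forall x, 0 <= g x) ->
  \int[nu]_x g x = \int[mu]_x (g x * (f x)%:E).
Proof.
move=> nuE mg g0.
have mF : measurable_fun setT (EFin \o f) by exact/measurable_EFinP.
have nnE (h : {nnsfun T >-> R}) : \int[nu]_x (h x)%:E = \int[mu]_x ((h x)%:E * (f x)%:E).
  under [LHS]eq_integral do rewrite fimfunE -fsumEFin//.
  rewrite [LHS]ge0_integral_fsum//; last 2 first.
    - by move=> r; exact/measurable_EFinP/measurableT_comp.
    - by move=> n x _; rewrite EFinM nnfun_muleindic_ge0.
  under [RHS]eq_integral.
    move=> x xD; rewrite fimfunE -fsumEFin// ge0_mule_fsuml; last first.
      by move=> r; rewrite EFinM nnfun_muleindic_ge0.
    over.
  rewrite [RHS]ge0_integral_fsum//; last 2 first.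
    - move=> r; apply: emeasurable_funM => //.
      exact/measurable_EFinP/measurableT_comp.
    - by move=> n x _; rewrite mule_ge0 ?lee_fin//; exact: nnfun_muleindic_ge0.
  apply: eq_fsbigr => r _.
  under [RHS]eq_integral do rewrite EFinM -muleA.
  have [r0|r0] := leP 0%R r; last first.
    rewrite preimage_nnfun0// !integral0_eq// => x _; rewrite indic0 ?mulr0//.
    by rewrite mul0e mule0.
  rewrite integralZl_indic_nnsfun//= integral_indic// setIT ge0_integralZl//.
  - rewrite nuE//; congr (_ * _); rewrite integral_mkcond; apply: eq_integral => x _.
    by rewrite patchE indicE; case: ifPn; rewrite ?mul1e ?mul0e.
  - by apply: emeasurable_funM => //; exact/measurable_EFinP/measurable_indic.
  - by move=> x _; rewrite mule_ge0// lee_fin.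
pose g_ := nnsfun_approx measurableT mg.
transitivity (lim (\int[nu]_x (g_ n x)%:E @[n --> \oo])).
  rewrite -monotone_convergence//=.
  - apply: eq_integral => ? /[!inE] xD; apply/esym/cvg_lim => //=.
    exact: cvg_nnsfun_approx.
  - by move=> n; exact/measurable_EFinP/measurable_funTS.
  - by move=> n ? _; rewrite lee_fin.
  - by move=> ? _ ? ? mn; rewrite lee_fin; exact/lefP/nd_nnsfun_approx.
under eq_fun do rewrite nnE.
rewrite -monotone_convergence//=.
- apply: eq_integral => x _; apply/cvg_lim => //.
  by apply: cvgeZr => //; exact: cvg_nnsfun_approx.
- by move=> n; apply: emeasurable_funM => //; exact/measurable_EFinP/measurable_funTS.
- by move=> n ? _; rewrite mule_ge0// lee_fin.
- by move=> x _ n m nm; apply: lee_wpmul2r; rewrite lee_fin//; exact/lefP/nd_nnsfun_approx.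
Qed.

End density.

(** * Translation of the Lebesgue and normal measures on the line *)

Section gaussian_shift.
Local Open Scope ereal_scope.
Context {R : realType}.
Local Notation mu := (@lebesgue_measure R).

(** Uniqueness of the Lebesgue measure reduces this to half-open intervals, whose length does not
    change under translation. *)
Lemma lebesgue_measure_shift (s : R) (A : set R) : measurable A ->
  pushforward mu (+%R^~ s : _ -> measurableTypeR R) A = mu A.
Proof.
have ms : measurable_fun setT (+%R^~ s : measurableTypeR R -> measurableTypeR R).
  exact: measurable_funD.
move=> mA; apply/esym/lebesgue_measure_unique => //= _ [[a b]] _ <-.
rewrite /pushforward.
have -> : +%R^~ s @^-1` `]a, b] = `](a - s)%R, (b - s)%R]%classic.
  by apply/seteqP; split => x /=; rewrite !in_itv/= ltrBlDr lerBrDr.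
by rewrite !lebesgue_measure_itv/= !lte_fin ltrD2r -!EFinD opprB addrA subrK.
Qed.

Lemma ge0_integral_shift (s : R) (g : R -> \bar R) :
  measurable_fun setT g -> (forall x, 0 <= g x) ->
  \int[mu]_x g (x + s)%R = \int[mu]_x g x.
Proof.
move=> mg g0.
have ms : measurable_fun setT (+%R^~ s : measurableTypeR R -> measurableTypeR R).
  exact: measurable_funD.
transitivity (\int[pushforward mu (+%R^~ s : _ -> measurableTypeR R)]_x g x).
  by rewrite ge0_integral_pushforward.
by apply: eq_measure_integral => //= A mA _; exact: lebesgue_measure_shift.
Qed.

Lemma ge0_integral_normal_prob (m s : R) (g : R -> \bar R) :
  measurable_fun setT g -> (forall x, 0 <= g x) ->
  \int[normal_prob m s]_x g x = \int[mu]_x (g x * (normal_pdf m s x)%:E).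
Proof.
move=> mg g0; apply: ge0_integral_density => //.
  exact: measurable_normal_pdf.
exact: normal_pdf_ge0.
Qed.

(** This is Cameron-Martin in dimension one: translation replaces the density at [x] by the density
    at [x - s], and the quotient of the two is exp(s x - s^2 / 2). *)
Lemma ge0_integral_normal_prob_shift (s : R) (g : R -> \bar R) :
  measurable_fun setT g -> (forall x, 0 <= g x) ->
  \int[normal_prob 0%R 1%R]_x g (x + s)%R =
  \int[normal_prob 0%R 1%R]_x (g x * (expR (s * x - s ^+ 2 / 2))%:E).
Proof.
move=> mg g0.
have ms : measurable_fun setT (fun x : R => x + s)%R by exact: measurable_funD.
have mt : measurable_fun setT (fun x : R => x - s)%R by exact: measurable_funB.
have me : measurable_fun setT (fun x => (expR (s * x - s ^+ 2 / 2))%:E).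
  apply/measurable_EFinP; apply: measurableT_comp => //.
  by apply: measurable_funB => //; exact: measurable_funM.
rewrite !ge0_integral_normal_prob//; last 3 first.
- exact: emeasurable_funM.
- by move=> x; rewrite mule_ge0// lee_fin expR_ge0.
- exact: measurableT_comp mg ms.
pose G y := g y * (normal_pdf 0 1 (y - s))%:E.
transitivity (\int[mu]_x G (x + s)%R).
  by apply: eq_integral => x _; rewrite /G addrK.
rewrite ge0_integral_shift; last 2 first.
- apply: emeasurable_funM => //; apply/measurable_EFinP.
  exact: measurableT_comp (measurable_normal_pdf 0%R 1%R) mt.
- by move=> x; rewrite mule_ge0// lee_fin normal_pdf_ge0.
apply: eq_integral => x _; rewrite /G -muleA -EFinM; congr (_ * _%:E).
rewrite !normal_pdfE ?oner_eq0// /normal_fun mulrCA -expRD; congr (_ * expR _)%R.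
by field.
Qed.

End gaussian_shift.

(** * The product sigma-algebra on row vectors *)

Section boxes.
Context {R : realType} {d : nat}.
Implicit Types B : 'I_d -> set R.

Definition box B : set 'rV[R]_d := [set u | forall j, B j (u 0 j)].

(** Boxes are closed under intersection and their probabilities can be read off from the
    independence of the coordinates; this is why they are chosen to generate the sigma-algebra on
    row vectors. *)
Definition boxes : set (set 'rV[R]_d) :=
  [set A | exists2 B, (forall j, measurable (B j)) & A = box B].

Local Notation V := (g_sigma_algebraType boxes).

Lemma measurable_box B : (forall j, measurable (B j)) ->
  measurable (box B : set V).
Proof. by move=> mB; apply: sub_sigma_algebra; exists B. Qed.

Lemma boxes_setI : setI_closed boxes.
Proof.
move=> _ _ [B mB ->] [C mC ->]; exists (fun j => B j `&` C j).
  by move=> j; exact: measurableI.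
by apply/seteqP; split => u; [move=> [Bu Cu] j; split|move=> BCu; split=> j; have [] := BCu j].
Qed.

Lemma boxT : box (fun=> setT) = setT.
Proof. by apply/seteqP; split. Qed.

Lemma measurable_coord (j : 'I_d) : measurable_fun setT (fun u : V => u 0 j).
Proof.
move=> _ A mA; rewrite setTI.
have -> : (fun u : V => u 0 j) @^-1` A = box (fun k => if k == j then A else setT).
  apply/seteqP; split => u /=; first by move=> Au k; case: eqP => [->|].
  by move=> /(_ j); rewrite eqxx.
by apply: measurable_box => k; case: ifP.
Qed.

Lemma measurable_fun_rV dT (T : measurableType dT) (f : T -> V) :
  (forall j, measurable_fun setT (fun w => f w 0 j)) -> measurable_fun setT f.
Proof.
move=> mf; apply: (@measurability _ _ T V setT f boxes) => // _ [_ [B mB ->] <-].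
rewrite setTI.
have -> : f @^-1` box B = \bigcap_(j in setT) ((fun w => f w 0 j) @^-1` B j).
  by apply/seteqP; split => w /= h j; [move=> _; exact: h|exact: (h j)].
apply: fin_bigcap_measurable => // j _; rewrite -[_ @^-1` _]setTI; exact: mf.
Qed.

Lemma measurable_dotv (v : 'rV[R]_d) : measurable_fun setT (fun u : V => dotv u v).
Proof.
apply: measurable_sum => j; apply: measurable_funM => //; exact: measurable_coord.
Qed.

Lemma measurable_addv (v : 'rV[R]_d) : measurable_fun setT (fun u : V => (u + v : V)).
Proof.
apply: measurable_fun_rV => j.
under eq_fun do rewrite mxE.
by apply: measurable_funD => //; exact: measurable_coord.
Qed.

(** The boxes form a pi-system that contains the whole space, so a finite measure is determined by
    its values on them. *)
Lemma box_measure_unique (m1 m2 : {measure set V -> \bar R}) :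
  (m1 setT < +oo)%E ->
  (forall B, (forall j, measurable (B j)) -> m1 (box B) = m2 (box B)) ->
  forall A, measurable A -> m1 A = m2 A.
Proof.
move=> m1oo m12; apply: (@measure_unique _ R V boxes (fun=> setT)) => //.
- exact: boxes_setI.
- by move=> _; exists (fun=> setT); rewrite ?boxT.
- exact: bigcup_const.
- by move=> _ [B mB ->]; exact: m12.
Qed.

(** Prescribing the values on boxes pins down the whole law, by [box_measure_unique]. *)
Definition std_gaussian_law (m : set V -> \bar R) := forall B,
  (forall j, measurable (B j)) -> m (box B) = (\prod_j normal_prob 0 1 (B j))%E.

End boxes.
Notation rVbox R d := (g_sigma_algebraType (@boxes R d)).

(** * The Cameron-Martin formula *)

Section cameron_martin.
Local Open Scope ereal_scope.
Context {R : realType} {d : nat}.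
Local Notation V := (rVbox R d).
Local Notation gauss := (@normal_prob R 0%R 1%R).
Variable m : probability V R.
Hypothesis gm : std_gaussian_law m.

(** As [B j] is the full line, [box B] constrains only the other coordinates, which are independent
    of coordinate [j]. Hence the restriction of [m] to [box B], pushed forward by coordinate [j], is
    a constant multiple of the normal law. *)
Lemma std_gaussian_law_coord (j : 'I_d) (B : 'I_d -> set R) (g : R -> \bar R) :
  (forall k, measurable (B k)) -> B j = setT ->
  measurable_fun setT g -> (forall x, 0 <= g x) ->
  \int[m]_(u in box B) g (u 0 j)%R =
  (\prod_(k | k != j) gauss (B k)) * \int[gauss]_x g x.
Proof.
move=> mB BjT mg g0.
have mE : measurable (box B : set V) by exact: measurable_box.
have mj := @measurable_coord R d j.
set c := \prod_(k | _) _.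
have c_ge0 : 0 <= c by exact: prode_ge0.
have c_fin : c \is a fin_num.
  by apply: prode_fin_num => k _; rewrite fin_num_measure; [|exact: mB].
transitivity (\int[mrestr m mE]_u g (u 0 j)%R).
  rewrite (@ge0_integral_density _ _ _ m (\1_(box B))) //.

  - rewrite [LHS]integral_mkcond. apply: (@eq_integral _ _ _ m setT) => u _.
    rewrite patchE indicE; have [uB|uB] := pselect (box B u).
      by rewrite !(mem_set uB) mule1.
    by rewrite !(memNset uB) mule0.
  - by move=> A mA; rewrite integral_indic// setIC.
  - exact: measurableT_comp mg mj.
pose cj (u : V) : measurableTypeR R := u 0%R j.
have mcj : measurable_fun setT cj := mj.
transitivity (\int[pushforward (mrestr m mE) cj]_x g x).
  by rewrite ge0_integral_pushforward.
(* The multiple [c] is viewed as a constant density, so that [ge0_integral_density] applies; its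
   hypothesis is verified on the box [BA] that has [A] in place [j]. *)
transitivity (\int[gauss]_x (g x * (cst (fine c) x)%:E)); last first.
  by rewrite /= ge0_integralZr// ?fineK//; exact: muleC.
apply: ge0_integral_density => //.
- by move=> x; exact: fine_ge0.
- move=> A mA; rewrite /= integral_cst//= fineK//.
  pose BA k := if k == j then A else B k.
  transitivity (m (box BA)).
    congr (m _).
    apply/seteqP; split => u /=.
      by rewrite /BA => -[Au Bu] k; case: eqP => [->|].
    move=> BAu; split; first by have := BAu j; rewrite /BA eqxx.
    by move=> k; have := BAu k; rewrite /BA; case: eqP => [->|//]; rewrite BjT.
  rewrite gm; last by move=> k; rewrite /BA; case: ifP => _ //; exact: mA.
  rewrite (bigD1 j)//= {1}/BA eqxx muleC; congr (_ * _).
  by apply: eq_bigr => k /negPf kj; rewrite /BA kj.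
Qed.

(** Both sides integrate [F] against a measure: the push-forward of [m] by the shift, and [m] with
    the exponential density. It suffices to compare these on boxes, where only the factor of
    coordinate [j] differs and the one-dimensional formula decides. *)
Lemma cameron_martin_coord (j : 'I_d) (s : R) (F : V -> \bar R) :
  measurable_fun setT F -> (forall u, 0 <= F u) ->
  \int[m]_u F (u + s *: delta_mx 0 j)%R =
  \int[m]_u (F u * (expR (s * u 0 j - s ^+ 2 / 2))%:E).
Proof.
move=> mF F0.
pose e (x : R) := expR (s * x - s ^+ 2 / 2).
have me : measurable_fun setT e.
  apply: measurableT_comp => //.
  by apply: measurable_funB => //; exact: measurable_funM.
pose h (u : V) : R := e (u 0%R j).
have mh : measurable_fun setT h := measurableT_comp me (@measurable_coord R d j).
have h0 u : (0 <= h u)%R by exact: expR_ge0.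
pose t (u : V) : V := (u + s *: delta_mx 0 j)%R.
have mt : measurable_fun setT t by exact: measurable_addv.
rewrite -(@ge0_integral_density _ _ _ m h mh h0 (mdensity m h mh h0))//.
rewrite -[LHS](@ge0_integral_pushforward _ _ _ _ _ t mt m setT F)//.
apply: eq_measure_integral => A mA _; apply: box_measure_unique mA.
  by rewrite -[X in X < _]/(m setT) probability_setT ltry.
move=> B mB; pose Bj k := if k == j then setT else B k.
have mBj k : measurable (Bj k) by rewrite /Bj; case: ifP.
have mshift : measurable_fun setT (fun x : R => x + s)%R by exact: measurable_funD.
pose Bs k := if k == j then (fun x => x + s)%R @^-1` B j else B k.
have mBs k : measurable (Bs k).
  by rewrite /Bs; case: ifP => // _; rewrite -[_ @^-1` _]setTI; exact: mshift.
have tB : t @^-1` box B = box Bs.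
  have tE u k : t u 0%R k = (if k == j then u 0 k + s else u 0 k)%R.
    rewrite /t !mxE eqxx/=; case: eqP => _; first by rewrite mulr1.
    by rewrite mulr0 addr0.
  by apply/seteqP; split => u /= H k; have := H k; rewrite ?tE /Bs;
     case: eqP => [->|] //.
rewrite -[LHS]/(m (t @^-1` box B)) tB gm//= (bigD1 j)//= muleC /mdensity.
(* The indicator of [box B] factors into that of [B j] at coordinate [j] and that of [box Bj], which
   leaves coordinate [j] free as [std_gaussian_law_coord] demands. *)
transitivity (\int[m]_(u in box Bj) ((\1_(B j) (u 0%R j))%:E * (h u)%:E)); last first.
  rewrite [LHS]integral_mkcond [RHS]integral_mkcond; apply: eq_integral => u _.
  rewrite !patchE indicE; have [uB|uB] := pselect (box B u).
    have uBj : box Bj u by move=> k; rewrite /Bj; case: eqP => // _; exact: uB.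
    by rewrite (mem_set uB) (mem_set uBj) (mem_set (uB j)) mul1e.
  rewrite (memNset uB); have [uBj|uBj] := pselect (box Bj u); last first.
    by rewrite (memNset uBj).
  rewrite (mem_set uBj) memNset ?mul0e// => uj; apply: uB => k.
  by have := uBj k; rewrite /Bj; case: eqP => // ->.
have mI : measurable_fun setT (fun x : R => (\1_(B j) x : R)%:E).
  exact/measurable_EFinP/measurable_indic.
have := @std_gaussian_law_coord j Bj (fun x => (\1_(B j) x)%:E * (e x)%:E) mBj.
move=> ->//; last 3 first.
- by rewrite /Bj eqxx.
- by apply: emeasurable_funM => //; exact/measurable_EFinP.
- by move=> x; rewrite mule_ge0// lee_fin expR_ge0.
congr (_ * _).
  by apply: eq_bigr => k /negPf kj; rewrite /Bs /Bj kj.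
rewrite -ge0_integral_normal_prob_shift//.
transitivity (\int[gauss]_x (\1_(Bs j) x : R)%:E).
  by rewrite integral_indic ?setIT//; exact: mBs.
by apply: eq_integral => x _; rewrite /= !indicE /Bs eqxx.
Qed.

Lemma cameron_martin (v : 'rV[R]_d) (F : V -> \bar R) :
  measurable_fun setT F -> (forall u, 0 <= F u) ->
  \int[m]_u F (u + v)%R =
  \int[m]_u (F u * (expR (dotv u v - dotv v v / 2))%:E).
Proof.
(* [w n] keeps the first [n] coordinates of [v]; the shift by [v] is done one
   coordinate at a time. *)
pose w n : 'rV[R]_d := \row_(k < d) (if (k < n)%N then v 0%R k else 0%R).
have dotwS (u : 'rV[R]_d) (j : 'I_d) : (dotv u (w j.+1) = dotv u (w j) + u 0 j * v 0 j)%R.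
  rewrite /dotv (bigD1 j)//= [in RHS](bigD1 j)//= !mxE ltnn ltnSn mulr0 add0r.
  rewrite addrC; congr (_ + _)%R; apply: eq_bigr => k kj; rewrite !mxE ltnS.
  by rewrite [in LHS]leq_eqVlt val_eqE (negPf kj).
have dotww (j : 'I_d) : (dotv (w j.+1) (w j.+1) = dotv (w j) (w j) + v 0 j ^+ 2)%R.
  rewrite /dotv (bigD1 j)//= [in RHS](bigD1 j)//= !mxE ltnn ltnSn mulr0 add0r.
  rewrite addrC -expr2; congr (_ + _)%R; apply: eq_bigr => k kj; rewrite !mxE ltnS.
  by rewrite [in LHS]leq_eqVlt val_eqE (negPf kj).
suff H n : (n <= d)%N -> forall F : V -> \bar R, measurable_fun setT F -> (forall u, 0 <= F u) ->
  \int[m]_u F (u + w n)%R = \int[m]_u (F u * (expR (dotv u (w n) - dotv (w n) (w n) / 2))%:E).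
  have wd : w d = v by apply/rowP => k; rewrite mxE ltn_ord.
  by move: (H d (leqnn d) F); rewrite wd.
elim: n => [_ {}F mF F0|n IH nd {}F mF F0].
  have w0 : w 0%N = 0%R by apply/rowP => k; rewrite !mxE.
  apply: eq_integral => u _; rewrite w0 addr0.
  have d0 x : dotv x (0 : 'rV[R]_d) = 0%R.
    by rewrite /dotv big1// => k _; rewrite mxE mulr0.
  by rewrite !d0 mul0r subr0 expR0 mule1.
pose j := Ordinal nd; pose s := v 0%R j.
have me : measurable_fun setT (fun u : V => (expR (s * u 0 j - s ^+ 2 / 2))%:E).
  apply/measurable_EFinP; apply: measurableT_comp => //.
  apply: measurable_funB => //; apply: measurable_funM => //.
  exact: measurable_coord.
transitivity (\int[m]_u F (u + s *: delta_mx 0 j + w n)%R).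
  apply: eq_integral => u _; congr F; rewrite -addrA; congr (_ + _)%R.
  apply/rowP => k; rewrite !mxE eqxx/= ltnS leq_eqVlt -(val_eqE k j)/=.
  case: eqVneq => [kn|]; last by rewrite mulr0 add0r.
  rewrite kn ltnn mulr1 addr0 /s; congr (v _ _); exact: val_inj.
have mFw : measurable_fun setT (fun u : V => F (u + w n)%R).
  exact: measurableT_comp mF (@measurable_addv R d (w n)).
apply: etrans (cameron_martin_coord j s _ mFw (fun u => F0 _)) _.
pose H (u : V) := F u * (expR (s * u 0%R j - s ^+ 2 / 2))%:E.
have mH : measurable_fun setT H by exact: emeasurable_funM.
have H0 u : 0 <= H u by rewrite mule_ge0// lee_fin expR_ge0.
(* [w n] vanishes at index [n], so shifting by it does not affect the exponential factor in [H]. *)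
transitivity (\int[m]_u H (u + w n)%R).
  by apply: eq_integral => u _; rewrite /H !mxE/= ltnn addr0.
apply: etrans (IH (ltnW nd) H mH H0) _.
apply: eq_integral => u _; rewrite /H -muleA -EFinM -expRD.
congr (_ * (expR _)%:E); rewrite (dotwS u j) (dotww j)/= -/s.
by field.
Qed.

End cameron_martin.

(** * Gaussian moments and weights invariant along a direction *)

Section weighted_mean.
Context {R : realType} {d : nat}.
Local Notation V := (rVbox R d).
Variable m : probability V R.
Hypothesis gm : std_gaussian_law m.

(** Cameron-Martin with the constant function 1 evaluates the integral as exp(|v|^2 / 2). *)
Lemma integrable_expR_dotv (v : 'rV[R]_d) :
  m.-integrable setT (fun u : V => (expR (dotv u v))%:E).
Proof.
have mE : measurable_fun setT (fun u : V => expR (dotv u v)).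
  by apply: measurableT_comp => //; exact: measurable_dotv.
apply/integrableP; split; first exact/measurable_EFinP.
have := cameron_martin m gm v (cst 1%E) (measurable_cst _) (fun=> lee01).
rewrite integral_cst//= probability_setT mule1 => H.
under eq_integral do rewrite ger0_norm ?expR_ge0//.
suff -> : (\int[m]_u (expR (dotv u v))%:E = (expR (dotv v v / 2))%:E)%E by rewrite ltry.
rewrite -[RHS]mule1 H -ge0_integralZl//.
- apply: eq_integral => u _; rewrite mul1e -EFinM -expRD; congr (expR _)%:E.
  by rewrite addrC subrK.
- apply: emeasurable_funM => //; apply/measurable_EFinP.
  by apply: measurableT_comp => //; apply: measurable_funB => //; exact: measurable_dotv.
Qed.

(** For z >= 0, squaring 1 + z / 2 <= exp(z / 2) gives z^2 / 4 <= exp z; the other sign follows by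
    symmetry. The bound turns exponential moments into second moments. *)
Lemma sqr_le_expR (z : R) : z ^+ 2 <= 4 * (expR z + expR (- z)).
Proof.
wlog z0 : z / 0 <= z => [H|].
  have [/H//|z0] := leP 0 z.
  by have := H (- z); rewrite opprK sqrrN [expR (- z) + _]addrC; apply; lra.
have h : 1 + z / 2 <= expR (z / 2) := expR_ge1Dx _.
have h2 : (1 + z / 2) ^+ 2 <= expR (z / 2) ^+ 2 by rewrite ler_sqr// nnegrE; lra.
have e : expR (z / 2) ^+ 2 = expR z by rewrite expr2 -expRD; congr expR; lra.
have := expR_ge0 (- z); move: h2; rewrite e; nra.
Qed.

Lemma dotvN (u v : 'rV[R]_d) : dotv u (- v) = - dotv u v.
Proof. by rewrite /dotv -sumrN; apply: eq_bigr => j _; rewrite mxE mulrN. Qed.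

Lemma dotvZ (a : R) (u v : 'rV[R]_d) : dotv u (a *: v) = a * dotv u v.
Proof. by rewrite /dotv mulr_sumr; apply: eq_bigr => j _; rewrite mxE mulrCA. Qed.

Lemma dotvZl (a : R) (u v : 'rV[R]_d) : dotv (a *: u) v = a * dotv u v.
Proof. by rewrite /dotv mulr_sumr; apply: eq_bigr => j _; rewrite mxE mulrA. Qed.

Lemma integrable_sqr_dotv (v : 'rV[R]_d) :
  m.-integrable setT (fun u : V => (dotv u v ^+ 2)%:E).
Proof.
have iE : m.-integrable setT
    (fun u : V => (4%:E * ((expR (dotv u v))%:E + (expR (dotv u (- v)))%:E))%E).
  by apply: integrableZl => //; apply: integrableD => //; exact: integrable_expR_dotv.
apply: le_integrable iE => //.
  by apply/measurable_EFinP; apply: measurable_funX; exact: measurable_dotv.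
move=> u _ /=; rewrite lee_fin dotvN ger0_norm ?sqr_ge0//.
by rewrite ger0_norm ?sqr_le_expR// mulr_ge0// addr_ge0 ?expR_ge0.
Qed.

Variable W : V -> R.
Hypotheses (mW : measurable_fun setT W) (W01 : forall u, 0 <= W u <= 1).

Lemma integrable_weight : m.-integrable setT (EFin \o W).
Proof.
apply: measurable_bounded_integrable => //.
  by rewrite -[X in (X < _)%E]/(m setT) probability_setT ltry.
exists 1; split => // M M1 u _ /=.
by have /andP[W0 W1] := W01 u; rewrite ger0_norm// (le_trans W1)// ltW.
Qed.

Lemma integrable_weight_dotv (v : 'rV[R]_d) :
  m.-integrable setT (fun u : V => (W u * dotv u v)%:E).
Proof.
have mD := @measurable_dotv R d v.
have iE : m.-integrable setT (fun u : V => (1 + (dotv u v ^+ 2)%:E)%E).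
  apply: integrableD => //; last exact: integrable_sqr_dotv.
  exact: finite_measure_integrable_cst.
apply: le_integrable iE => //.
  by apply/measurable_EFinP; exact: measurable_funM.
move=> u _ /=; rewrite lee_fin normrM.
have /andP[W0 W1] := W01 u; rewrite (ger0_norm W0).
rewrite [leRHS]ger0_norm; last by rewrite addr_ge0 ?sqr_ge0.
rewrite (@le_trans _ _ `|dotv u v|)// ?ler_piMl// -real_normK ?num_real//.
by have := normr_ge0 (dotv u v); set a := `| _ |; nra.
Qed.

Lemma weight_dotv_le0 (v : 'rV[R]_d) :
  (forall u t, W (u + t *: v) = W u) ->
  \int[m]_u (W u * dotv u v) <= 0.
Proof.
move=> Wv; set I := Rintegral _ _ _; set c := dotv v v / 2.
have c0 : 0 <= c.
  by rewrite /c divr_ge0// /dotv sumr_ge0// => j _; rewrite -expr2 sqr_ge0.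
(* [1 + y <= expR y] at [y = t * dotv u v], integrated against [W] and evaluated
   with the Cameron-Martin formula. *)
have key t : 0 < t -> t * I <= expR (t ^+ 2 * c) - 1.
  move=> t0; set E := \int[m]_u W u.
  have E1 : E <= 1.
    have -> : 1 = \int[m]_u (cst 1 u) :> R.
      by rewrite Rintegral_cst//= probability_setT/= mul1r.
    apply: le_Rintegral => //; first exact: integrable_weight.
      exact: finite_measure_integrable_cst.
    by move=> u _; have /andP[] := W01 u.
  have mDt := @measurable_dotv R d v.
  pose e (u : V) := expR (t * dotv u v - t ^+ 2 * c).
  have me : measurable_fun setT e.
    by apply: measurableT_comp => //; apply: measurable_funB => //; exact: measurable_funM.
  have e_expand u : expR (dotv u (t *: v) - dotv (t *: v) (t *: v) / 2) = e u.
    by rewrite /e /c !dotvZ dotvZl; congr expR; field.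
  have CM : (\int[m]_u (W u)%:E = \int[m]_u (W u * e u)%:E)%E.
    have := cameron_martin m gm (t *: v) (EFin \o W).
    move=> /(_ _ _)/esym CM; rewrite -[RHS]/(\int[m]_u ((EFin \o W) u * (e u)%:E)%E)%E.
    under [RHS]eq_integral do rewrite -e_expand.
    rewrite CM; first by apply: eq_integral => u _; rewrite /= Wv.
    - exact/measurable_EFinP.
    - by move=> u; rewrite lee_fin; have /andP[] := W01 u.
  have iWe : m.-integrable setT (EFin \o (fun u => W u * e u)).
    apply/integrableP; split; first by apply/measurable_EFinP; exact: measurable_funM.
    under eq_integral.
      move=> u _; rewrite /= ger0_norm; last first.
        by rewrite mulr_ge0 ?expR_ge0//; have /andP[] := W01 u.
      over.
    by rewrite -CM; exact: integrable_lty integrable_weight.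
  have iWZ := integrable_weight_dotv v.
  have iZt : m.-integrable setT (EFin \o (fun u => t * (W u * dotv u v))).
    exact: (integrableZl measurableT t iWZ).
  (* The right-hand [E] is rewritten by [CM] as the integral of [W u * e u], whose integrand is at
     least exp(- t^2 c) W(u) (1 + t <u, v>). *)
  have : expR (- (t ^+ 2 * c)) * (E + t * I) <= E.
    rewrite {2}/E /Rintegral CM -/(Rintegral m setT (fun u => W u * e u)).
    have -> : E + t * I = \int[m]_u (W u + t * (W u * dotv u v)).
      by rewrite RintegralD ?RintegralZl//; exact: integrable_weight.
    have iS : m.-integrable setT (EFin \o (fun u => W u + t * (W u * dotv u v))).
      exact: (integrableD measurableT integrable_weight iZt).
    rewrite -RintegralZl//; apply: le_Rintegral => //.
      exact: (integrableZl measurableT _ iS).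
    move=> u _; have /andP[W0 _] := W01 u.
    rewrite /e expRD [X in _ <= X]mulrA [X in _ <= X]mulrC ler_wpM2l ?expR_ge0//.
    rewrite (_ : W u + _ = W u * (1 + t * dotv u v)); last by ring.
    by rewrite ler_wpM2l// expR_ge1Dx.
  (* Now E + t I <= exp(t^2 c) E, so t I <= (exp(t^2 c) - 1) E, and 0 <= E <= 1 removes the last
     factor. *)
  rewrite expRN ler_pdivrMl ?expR_gt0// => h.
  have := expR_ge1Dx (t ^+ 2 * c); have : 0 <= t ^+ 2 * c by rewrite mulr_ge0// sqr_ge0.
  have E0 : 0 <= E by apply: Rintegral_ge0 => u _; have /andP[] := W01 u.
  by move: h; set x := expR _; nra.
rewrite leNgt; apply/negP => I0.
(* [t] is small enough for [key t] to contradict [0 < I], since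
   [expR x <= 1 + 2 * x] on [[0, 1/2]]. *)
pose D := 4 * (c + 1) * (I + 1).
have D0 : 0 < D by rewrite /D; nra.
pose t := I / D.
have tD : t * D = I by rewrite /t divfK// gt_eqF.
have t0 : 0 < t by rewrite divr_gt0.
have ct0 : 0 <= c * t by rewrite mulr_ge0// ltW.
(* Thus 4 (c + 1) t = I / (I + 1), which lies below both 1 and I; the choice of [D] serves this
   purpose. *)
have tDI : (4 * (c * t) + 4 * t) * (I + 1) = I by rewrite -[RHS]tD /D; ring.
have y0 : 0 < 4 * (c * t) + 4 * t by lra.
have [t1 tI] : 4 * (c * t) + 4 * t < 1 /\ 4 * (c * t) + 4 * t < I.
  by move: tDI y0; set y := 4 * _ + _ => tDI y0; split; nra.
have x0 : 0 <= t ^+ 2 * c by rewrite mulr_ge0// sqr_ge0.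
have x2 : t ^+ 2 * c <= 2^-1.
  rewrite (_ : _ * c = t * (c * t)); last by ring.
  by rewrite (@le_trans _ _ (2^-1 * 1))// ?ler_pM//; lra.
(* From 1 - x <= exp(-x) one gets exp x <= 1 / (1 - x), which is at most 1 + 2 x for 0 <= x <=
   1/2. *)
have ex : expR (t ^+ 2 * c) <= 1 + 2 * (t ^+ 2 * c).
  have := expR_ge1Dx (- (t ^+ 2 * c)); rewrite expRN.
  move: x2 x0; set x := t ^+ 2 * c; have := expR_gt0 x; set y := expR x => yp x2 x0 hy.
  have : y * (1 - x) <= 1 by rewrite mulrC -ler_pdivlMr// div1r.
  by nra.
have : t * I <= t * (2 * (c * t)).
  by rewrite (le_trans (key t t0))// (_ : t * _ = 2 * (t ^+ 2 * c)); [lra|ring].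
by rewrite ler_pM2l//; lra.
Qed.

Lemma weight_dotv_eq0 (v : 'rV[R]_d) :
  (forall u t, W (u + t *: v) = W u) ->
  \int[m]_u (W u * dotv u v) = 0.
Proof.
move=> Wv; apply/eqP; rewrite eq_le weight_dotv_le0//=.
have := weight_dotv_le0 (- v) => /(_ _)/wrap[u t|].
  by rewrite scalerN -scaleNr Wv.
rewrite (_ : \int[m]_u (W u * dotv u (- v)) = \int[m]_u (-1 * (W u * dotv u v))).
  by rewrite RintegralZl// ?mulN1r ?oppr_le0//; exact: integrable_weight_dotv.
by apply: eq_Rintegral => u _; rewrite dotvN mulrN mulN1r.
Qed.

End weighted_mean.

(** * A strong law of large numbers *)

Section interpolation.
Context {R : realType}.

Lemma ex_sqrn (M : nat) : exists q, (q ^ 2 <= M < q.+1 ^ 2)%N.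
Proof.
elim: M => [|M [q /andP[qM Mq]]]; first by exists 0%N.
have [h|h] := ltnP M.+1 (q.+1 ^ 2); first by exists q; rewrite h (leq_trans qM).
exists q.+1; rewrite h /=; apply: leq_ltn_trans Mq _.
by rewrite ltn_exp2r.
Qed.

(** If q^2 <= M < (q+1)^2, monotonicity squeezes S(M) / M between S(q^2) / (q+1)^2 and S((q+1)^2) /
    q^2. These are terms of the subsequence up to the factor q^2 / (q+1)^2 or its inverse, which
    tends to 1. *)
Lemma cvg_mean_of_square_subsequence (S : nat -> R) (l : R) :
  (forall n, 0 <= S n) -> {homo S : m n / (m <= n)%N >-> m <= n} ->
  S (k.+1 ^ 2)%N / (k.+1 ^ 2)%:R @[k --> \oo] --> l ->
  S M / M%:R @[M --> \oo] --> l.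
Proof.
move=> S0 Smono; set a := fun k : nat => _; rewrite -/a => al.
have [q qP] := choice ex_sqrn.
(* The subsequence is indexed from [k.+1 ^ 2], hence the predecessor: for [M > 0],
   [(p M).+1 ^ 2 <= M < (p M).+2 ^ 2]. *)
pose p M := (q M).-1.
have poo : p M @[M --> \oo] --> \oo.
  apply/cvgnyPge => n; near=> M.
  have Mn : (n.+1 ^ 2 <= M)%N by near: M; exact: nbhs_infty_ge.
  have /andP[_ Mq] := qP M.
  have := leq_ltn_trans Mn Mq; rewrite ltn_exp2r// ltnS /p => nq.
  by case: (q M) nq.
(* This is the ratio (k+1)^2 / (k+2)^2, in a form whose limit is visible. *)
pose r (k : nat) : R := (1 - k.+2%:R^-1) ^+ 2.
have r1 : r k @[k --> \oo] --> (1 : R).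
  have h : (k.+2%:R^-1 : R) @[k --> \oo] --> (0 : R).
    by rewrite (cvg_shiftS (@harmonic R)); exact: cvg_harmonic.
  rewrite -[X in _ --> X](_ : (1 - 0) ^+ 2 = 1 :> R); last by rewrite subr0 expr1n.
  rewrite /r; under eq_fun do rewrite expr2; rewrite expr2.
  by apply: cvgM; (apply: cvgB; [exact: cvg_cst|exact: h]).
have low : (a k * r k) @[k --> \oo] --> l.
  by rewrite -[X in _ --> X]mulr1; exact: cvgM.
have rV1 : (r k)^-1 @[k --> \oo] --> (1 : R).
  by rewrite -[X in _ --> X]invr1; apply: cvgV => //; exact: oner_neq0.
have up : (a k.+1 * (r k)^-1) @[k --> \oo] --> l.
  rewrite -[X in _ --> X]mulr1; apply: cvgM => //.
  by move: al; rewrite -(cvg_shiftS a).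
apply: (squeeze_cvgr _ (cvg_comp _ _ poo low) (cvg_comp _ _ poo up)).
near=> M => /=.
have M0 : (0 < M)%N by near: M; exact: nbhs_infty_gt.
have /andP[qM Mq] := qP M.
have q0 : (0 < q M)%N.
  by case: (q M) Mq => [|//]; rewrite exp1n ltnS leqn0 => /eqP M00; rewrite M00 in M0.
have qE : q M = (p M).+1 by rewrite /p prednK.
rewrite qE in qM Mq; set k := p M in qM Mq *.
have MR : 0 < M%:R :> R by rewrite ltr0n.
have kR : 0 < k.+1%:R :> R by rewrite ltr0n.
have kkR : 0 < k.+2%:R :> R by rewrite ltr0n.
have rE : r k = k.+1%:R ^+ 2 / k.+2%:R ^+ 2.
  have kE : k.+2%:R = k.+1%:R + 1 :> R by rewrite natr1.
  have : k.+1%:R + 1 != 0 :> R by rewrite -kE lt0r_neq0.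
  by rewrite /r kE; set y := k.+1%:R => y0; field.
have qMR : k.+1%:R ^+ 2 <= M%:R :> R by rewrite -natrX ler_nat.
have MqR : M%:R <= k.+2%:R ^+ 2 :> R by rewrite -natrX ler_nat ltnW.
apply/andP; split.
  rewrite /a rE natrX mulrA divfK ?lt0r_neq0 ?exprn_gt0//.
  by rewrite ler_pM ?invr_ge0 ?ler0n ?exprn_ge0 ?Smono// lef_pV2// posrE ?exprn_gt0.
rewrite /a rE natrX invf_div mulrA divfK ?lt0r_neq0 ?exprn_gt0//.
by rewrite ler_pM ?invr_ge0 ?ler0n ?Smono ?(ltnW Mq)// lef_pV2// posrE ?exprn_gt0.
Unshelve. all: by end_near. Qed.

End interpolation.

Section strong_law.
Context {R : realType} {d} {T : measurableType d} (P : probability T R).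
Variables (Y : nat -> T -> R) (m C : R).
(** [EYY] bounds the second moments when [i = k] and says that distinct variables are not positively
    correlated otherwise. As the integrands are nonnegative, extended integrals express this without
    integrability conditions. *)
Hypotheses (mY : forall i, measurable_fun setT (Y i))
  (Y0 : forall i w, 0 <= Y i w)
  (EY : forall i, (\int[P]_w (Y i w)%:E = m%:E)%E)
  (C0 : 0 <= C)
  (EYY : forall i k, (\int[P]_w (Y i w * Y k w)%:E <= (m ^+ 2 + (i == k)%:R * C)%:E)%E).

Let S M w := \sum_(i < M) Y i w.

Let mS M : measurable_fun setT (S M).
Proof. by apply: measurable_sum => i; exact: mY. Qed.

Let S0 M w : 0 <= S M w. Proof. exact: sumr_ge0. Qed.

Let m0 : 0 <= m.
Proof.
by rewrite -lee_fin -(EY 0%N); apply: integral_ge0 => w _; rewrite lee_fin.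
Qed.

(** When the square of the sum is expanded, the terms m^2 add up to the square of the mean and only
    the [M] diagonal terms contribute [C]. *)
Lemma sum_second_central_moment M :
  (\int[P]_w ((S M w - M%:R * m) ^+ 2)%:E <= (M%:R * C)%:E)%E.
Proof.
set c := M%:R * m.
have c0 : 0 <= c by rewrite mulr_ge0.
have ES : (\int[P]_w (S M w)%:E = c%:E)%E.
  under eq_integral do rewrite /S -sumEFin.
  rewrite ge0_integral_sum//; last 2 first.
  - by move=> i; exact/measurable_EFinP.
  - by move=> i w _; rewrite lee_fin.
  under eq_bigr do rewrite EY.
  by rewrite sumEFin sumr_const card_ord /c mulr_natl.
have ESS : (\int[P]_w (S M w ^+ 2)%:E <= (c ^+ 2 + M%:R * C)%:E)%E.
  have -> : (\int[P]_w (S M w ^+ 2)%:E =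
      \sum_(i < M) \sum_(k < M) \int[P]_w (Y i w * Y k w)%:E)%E.
    transitivity (\int[P]_w (\sum_(i < M) \sum_(k < M) (Y i w * Y k w)%:E))%E.
      apply: eq_integral => w _; rewrite expr2 /S mulr_suml -sumEFin.
      by apply: eq_bigr => i _; rewrite mulr_sumr -sumEFin.
    have mYY i k : measurable_fun setT (fun w => (Y i w * Y k w)%:E).
      by apply/measurable_EFinP; exact: measurable_funM.
    have YY0 i k w : (0 <= (Y i w * Y k w)%:E)%E by rewrite lee_fin mulr_ge0.
    rewrite ge0_integral_sum//; last 2 first.
    - by move=> i; exact: emeasurable_sum.
    - by move=> i w _; exact: sume_ge0.
    by apply: eq_bigr => i _; rewrite ge0_integral_sum.
  apply: (@le_trans _ _ (\sum_(i < M) \sum_(k < M) (m ^+ 2 + (i == k)%:R * C)%:E)%E).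
    by apply: lee_sum => i _; apply: lee_sum => k _; exact: EYY.
  under eq_bigr do rewrite sumEFin; rewrite sumEFin lee_fin.
  under eq_bigr => i _.
    rewrite big_split/= sumr_const card_ord (bigD1 i)//= eqxx mul1r big1 ?addr0; last first.
      by move=> k /negPf ki; rewrite eq_sym ki mul0r.
    over.
  rewrite sumr_const card_ord -[leLHS]mulr_natl -[m ^+ 2 *+ M]mulr_natl /c.
  by rewrite le_eqVlt; apply/orP; left; apply/eqP; ring.
have mf : measurable_fun setT (fun w => (S M w - c) ^+ 2).
  by apply: measurable_funX; exact: measurable_funB.
(* The identity (S - c)^2 + 2 c S = S^2 + c^2 has only nonnegative terms, so it can be integrated
   term by term in the extended reals. *)
have : (\int[P]_w ((S M w - c) ^+ 2)%:E + (2 * c)%:E * \int[P]_w (S M w)%:E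
    = \int[P]_w (S M w ^+ 2)%:E + (c ^+ 2)%:E)%E.
  rewrite -ge0_integralZl//; last 3 first.
  - exact/measurable_EFinP.
  - by move=> w _; rewrite lee_fin.
  - by rewrite lee_fin mulr_ge0.
  rewrite -ge0_integralD//; last 4 first.
  - by move=> w _; rewrite lee_fin sqr_ge0.
  - exact/measurable_EFinP.
  - by move=> w _; rewrite -EFinM lee_fin !mulr_ge0.
  - by apply: emeasurable_funM => //; exact/measurable_EFinP.
  have -> : (c ^+ 2)%:E = (\int[P]_w (cst (c ^+ 2)%:E w))%E.
    by rewrite integral_cst//= probability_setT mule1.
  rewrite -ge0_integralD//; last 3 first.
  - by move=> w _; rewrite lee_fin sqr_ge0.
  - by apply/measurable_EFinP; exact: measurable_funX.
  - by move=> w _; rewrite lee_fin sqr_ge0.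
  by apply: eq_integral => w _; rewrite /= -EFinM -!EFinD; congr _%:E; ring.
rewrite ES -EFinM => E.
rewrite -(@leeD2rE _ (2 * c * c)%:E)// E.
rewrite (@le_trans _ _ ((c ^+ 2 + M%:R * C)%:E + (c ^+ 2)%:E)%E)// ?leeD2r//.
by rewrite -!EFinD lee_fin; lra.
Qed.

(** The squared deviations along k^2 have summable expectations. Their sum is therefore integrable,
    hence finite almost everywhere, and its terms tend to 0. *)
Lemma ae_square_subsequence :
  {ae P, forall w, S (k.+1 ^ 2)%N w / (k.+1 ^ 2)%:R @[k --> \oo] --> m}.
Proof.
pose D k w := (S (k.+1 ^ 2)%N w / (k.+1 ^ 2)%:R - m) ^+ 2.
have mD k : measurable_fun setT (D k).
  by apply: measurable_funX; apply: measurable_funB => //; exact: measurable_funM.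
have D0 k w : 0 <= D k w by exact: sqr_ge0.
(* The variance bound C / (k+1)^2 is relaxed to a telescoping one by 1 / y^2 <= 2 / (y (y + 1)) for
   y >= 1; the total is then at most 2 C. *)
have ED k : (\int[P]_w (D k w)%:E <= (C * 2 * (k.+1%:R^-1 - k.+2%:R^-1))%:E)%E.
  set M := (k.+1 ^ 2)%N; have M0 : 0 < M%:R :> R by rewrite ltr0n expn_gt0.
  have -> : (\int[P]_w (D k w)%:E =
      (M%:R ^- 2)%:E * \int[P]_w ((S M w - M%:R * m) ^+ 2)%:E)%E.
    rewrite -ge0_integralZl//.
    - apply: eq_integral => w _; rewrite -EFinM /D -/M; congr _%:E.
      by field; rewrite lt0r_neq0.
    - apply/measurable_EFinP; apply: measurable_funX; exact: measurable_funB.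
    - by move=> w _; rewrite lee_fin sqr_ge0.
  apply: (@le_trans _ _ ((M%:R ^- 2)%:E * (M%:R * C)%:E)%E).
    by apply: lee_wpmul2l; [rewrite lee_fin invr_ge0 exprn_ge0// ltW|
       exact: sum_second_central_moment].
  rewrite -EFinM lee_fin (_ : M%:R ^- 2 * _ = C * M%:R^-1); last first.
    by move: M0; set y := M%:R => y0; field; rewrite lt0r_neq0.
  rewrite -mulrA ler_wpM2l// /M natrX.
  have kE : k.+2%:R = k.+1%:R + 1 :> R by rewrite natr1.
  have k1 : 1 <= k.+1%:R :> R by rewrite ler1n.
  rewrite kE; move: (k.+1%:R : R) k1 => y y1.
  have y0 : 0 < y by lra.
  rewrite (_ : 2 * _ = 2 / (y * (y + 1))); last by field; apply/andP; split; lra.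
  rewrite -[y ^- 2]div1r ler_pdivrMr ?exprn_gt0//.
  rewrite mulrAC ler_pdivlMr ?mulr_gt0//; last by lra.
  by nra.
have sumD : (\int[P]_w (\sum_(k <oo) (D k w)%:E) < +oo)%E.
  rewrite integral_nneseries//; last 2 first.
  - by move=> k; exact/measurable_EFinP.
  - by move=> k w _; rewrite lee_fin.
  apply: (@le_lt_trans _ _ (\sum_(k <oo) (C * 2 * (k.+1%:R^-1 - k.+2%:R^-1))%:E)%E).
    apply: lee_nneseries => [k _ _|k _]; last exact: ED.
    by apply: integral_ge0 => w _; rewrite lee_fin.
  have uE n : (\sum_(0 <= k < n) (C * 2 * (k.+1%:R^-1 - k.+2%:R^-1))%:E
      = (C * 2 * (1 - n.+1%:R^-1))%:E)%E.
    rewrite sumEFin -mulr_sumr; congr (_ * _)%:E.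
    elim: n => [|n IH]; first by rewrite big_nil invr1 subrr.
    by rewrite big_nat_recr//= IH addrA subrK.
  apply: (@le_lt_trans _ _ (C * 2)%:E); last by rewrite ltry.
  apply: lime_le.
    apply: is_cvg_nneseries => k _ _; rewrite lee_fin !mulr_ge0// subr_ge0.
    by rewrite lef_pV2 ?posrE// ler_nat.
  by near=> n; rewrite uE lee_fin ler_piMr ?mulr_ge0// lerBlDr lerDl.
have mser : measurable_fun setT (fun w => \sum_(k <oo) (D k w)%:E)%E.
  apply: ge0_emeasurable_sum => [k w _ _|k _]; first by rewrite lee_fin.
  exact/measurable_EFinP.
have iser : P.-integrable setT (fun w => \sum_(k <oo) (D k w)%:E)%E.
  apply/integrableP; split => //.
  under eq_integral.
    move=> w _; rewrite gee0_abs; last by apply: nneseries_ge0 => k _ _; rewrite lee_fin.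
    over.
  exact: sumD.
have := integrable_ae measurableT iser; apply: filterS => w /(_ Logic.I) fin.
have cD : cvgn (series (D ^~ w)).
  by apply: nnseries_is_cvg => //; rewrite ltey_eq fin.
have D0' := cvg_series_cvg_0 cD.
have : (Num.sqrt (D k w) @[k --> \oo] --> Num.sqrt (0 : R)).
  by apply: (cvg_comp _ _ D0'); exact: sqrt_continuous.
rewrite sqrtr0 /D; under eq_fun do rewrite sqrtr_sqr.
by move=> /norm_cvg0P; rewrite subr_cvg0.
Unshelve. all: by end_near. Qed.

Theorem strong_law_nonneg :
  {ae P, forall w, (\sum_(i < M) Y i w) / M%:R @[M --> \oo] --> m}.
Proof.
apply: filterS ae_square_subsequence => w Sw.
apply: (@cvg_mean_of_square_subsequence R (fun M => S M w)) => // a b ab.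
rewrite /S -(subnKC ab) big_split_ord/= lerDl; exact: sumr_ge0.
Qed.

End strong_law.

(** * The samples *)

Section iid_gaussian.
Context {R : realType} {dT : measure_display} {T : measurableType dT}.
Context (P : probability T R) {d : nat} {n : nat -> T -> 'rV[R]_d}.
Hypothesis iid : iid_std_gaussian P n.
Local Notation V := (rVbox R d).
Local Notation gauss := (@normal_prob R 0%R 1%R).

Lemma measurable_sample i : measurable_fun setT (n i : T -> V).
Proof. by apply: measurable_fun_rV => j; have [+ _ _] := iid; exact. Qed.

Let X i : {mfun T >-> V} := HB.pack (n i : T -> V)
  (isMeasurableFun.Build _ _ _ _ (n i : T -> V) (measurable_sample i)).

(** A family of boxes is one finite family of coordinate events indexed by the pairs (i, j), to
    which the joint independence of all coordinates applies. *)
Lemma prob_sample_boxes (s : seq nat) (B : nat -> 'I_d -> set R) : uniq s ->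
  (forall i j, measurable (B i j)) ->
  P (\bigcap_(i in [set` s]) (n i @^-1` box (B i))) =
  (\prod_(i <- s) \prod_j gauss (B i j))%E.
Proof.
move=> us mB; have [_ nE indep] := iid.
pose F := [seq (i, j) | i <- s, j <- enum 'I_d].
have uF : uniq F by apply: allpairs_uniq; rewrite ?enum_uniq// => -[? ?] [].
have := indep F (fun ij => B ij.1 ij.2) uF (fun _ _ => mB _ _).
rewrite big_allpairs => E.
transitivity (P (\bigcap_(ij in [set` F]) ((fun w => n ij.1 w 0 ij.2) @^-1` B ij.1 ij.2))).
  congr (P _); apply/seteqP; split => w /= h.
    by move=> [i j]/= /allpairsP[[a b]/= [sa _ [-> ->]]]; exact: h.
  move=> i /= si j; apply: (h (i, j)) => /=.
  by apply/allpairsP; exists (i, j); rewrite mem_enum.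
rewrite E; apply: eq_bigr => i _; rewrite big_enum/=.
by apply: eq_bigr => j _; rewrite nE.
Qed.

Lemma std_gaussian_law_sample i : std_gaussian_law (distribution P (X i)).
Proof.
move=> B mB; have := @prob_sample_boxes [:: i] (fun=> B) isT (fun=> mB).
rewrite big_seq1 => <-; congr (P _); apply/seteqP; split => w /=.
  by move=> Bw k /=; rewrite inE => /eqP->.
by apply => /=; rewrite inE.
Qed.

Definition sample_law : probability V R := distribution P (X 0%N).

Local Notation m := sample_law.

Lemma std_gaussian_sample_law : std_gaussian_law m.
Proof. exact: std_gaussian_law_sample. Qed.

Lemma sample_same_law i (A : set V) : measurable A -> P (n i @^-1` A) = m A.
Proof.
apply: (box_measure_unique (distribution P (X i))).
  by rewrite -[X in (X < _)%E]/(P setT) probability_setT ltry.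
move=> B mB; have H := std_gaussian_law_sample.
exact: etrans (H i _ mB) (esym (H 0%N _ mB)).
Qed.

Lemma ge0_integral_sample i (h : V -> \bar R) :
  measurable_fun setT h -> (forall u, 0 <= h u)%E ->
  (\int[P]_w h (n i w) = \int[m]_u h u)%E.
Proof.
move=> mh h0; rewrite -(@ge0_integral_distribution _ _ _ _ _ P (X i))//.
by apply: eq_measure_integral => A mA _; exact: sample_same_law.
Qed.

Lemma sample_boxes_independent i k (B C : 'I_d -> set R) : i != k ->
  (forall j, measurable (B j)) -> (forall j, measurable (C j)) ->
  P (n i @^-1` box B `&` n k @^-1` box C) = (m (box B) * m (box C))%E.
Proof.
move=> ik mB mC; rewrite !std_gaussian_sample_law//.
have := @prob_sample_boxes [:: i; k] (fun a => if a == i then B else C).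
rewrite big_cons big_seq1 eqxx [k == i]eq_sym (negPf ik) /= inE ik => <- //; last first.
  by move=> a; case: ifP.
congr (P _); apply/seteqP; split => w /=.
  by move=> [Bw Cw] a /=; rewrite !inE => /orP[]/eqP->; rewrite ?eqxx// eq_sym (negPf ik).
move=> h; split; first by have := h i; rewrite /= eqxx; apply; rewrite !inE eqxx.
by have := h k; rewrite /= [k == i]eq_sym (negPf ik); apply; rewrite !inE eqxx orbT.
Qed.

(** Independence passes from boxes to measurable sets one factor at a time: with one event fixed,
    both sides are finite measures in the other event and agree on boxes. *)
Lemma sample_independent i k (A C : set V) : i != k ->
  measurable A -> measurable C ->
  P (n i @^-1` A `&` n k @^-1` C) = (m A * m C)%E.
Proof.
move=> ik mA mC.
have mnA a (D : set V) : measurable D -> measurable (n a @^-1` D).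
  by move=> mD; rewrite -[_ @^-1` _]setTI; exact: measurable_sample.
(* [mscale] takes a nonnegative real factor, so the finite mass of [D] is repackaged as one. *)
pose r (D : set V) : {nonneg R} := NngNum (fine_ge0 (measure_ge0 m D)).
have rE D : measurable D -> ((r D)%:num%:E = m D)%E.
  by move=> mD; rewrite /= fineK// fin_num_measure.
have step1 B : (forall j, measurable (B j)) ->
    P (n i @^-1` A `&` n k @^-1` box B) = (m A * m (box B))%E.
  move=> mB; have mbB := measurable_box B mB.
  transitivity (mscale (r (box B)) m A); last by rewrite /mscale rE// muleC.
  pose Q := pushforward (mrestr P (mnA k _ mbB)) (X i).
  rewrite -[LHS]/(Q A); apply: box_measure_unique mA.
    rewrite -[X in (X < _)%E]/(P (n i @^-1` setT `&` n k @^-1` box B)).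
    apply: le_lt_trans (ltry 1%R); apply: probability_le1.
    by apply: measurableI; exact/mnA.
  move=> D mD; rewrite -[LHS]/(P _) sample_boxes_independent//.
  by rewrite [RHS]/(mscale _ _ _) /= rE// muleC.
transitivity (mscale (r A) m C); last by rewrite /mscale rE.
pose Q := pushforward (mrestr P (mnA i _ mA)) (X k).
transitivity (Q C); first by rewrite /Q /pushforward /mrestr setIC.
apply: box_measure_unique mC.
  rewrite -[X in (X < _)%E]/(P (n k @^-1` setT `&` n i @^-1` A)).
  apply: le_lt_trans (ltry 1%R); apply: probability_le1.
  by apply: measurableI; exact/mnA.
by move=> D mD; rewrite -[LHS]/(P _) setIC step1//= /mscale rE.
Qed.

(** By independence the joint law of the two samples is the product measure, and Tonelli splits the
    integral. *)
Lemma ge0_integral_sample_pair i k (h : V -> \bar R) : i != k ->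
  measurable_fun setT h -> (forall u, 0 <= h u)%E ->
  (\int[P]_w (h (n i w) * h (n k w)) = (\int[m]_u h u) * (\int[m]_u h u))%E.
Proof.
move=> ik mh h0.
pose Z w : V * V := (n i w, n k w).
have mZ : measurable_fun setT Z.
  by apply: measurable_fun_pair; exact: measurable_sample.
pose H (z : V * V) := (h z.1 * h z.2)%E.
have mH : measurable_fun setT H.
  by apply: emeasurable_funM; exact: measurableT_comp.
have H0 z : (0 <= H z)%E by rewrite mule_ge0.
transitivity (\int[pushforward P Z]_z H z)%E.
  by rewrite ge0_integral_pushforward.
transitivity (\int[(m \x m)%E]_z H z)%E.
  apply: eq_measure_integral => A mA _; apply/esym.
  by apply: product_measure_unique => // B C mB mC; exact: sample_independent.
rewrite fubini_tonelli1// /fubini_F /H /=.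
under eq_integral do rewrite ge0_integralZl//.
by rewrite ge0_integralZr//; exact: integral_ge0.
Qed.

End iid_gaussian.

(** * The strong law for functions of the samples *)

Section weighted_estimate.
Context {R : realType} {dT : measure_display} {T : measurableType dT}.
Context (P : probability T R) {d : nat} {n : nat -> T -> 'rV[R]_d}.
Hypothesis iid : iid_std_gaussian P n.
Local Notation V := (rVbox R d).
Local Notation m := (sample_law P iid).

(** Integrability is returned with the limit because the signed case subtracts the integrals of the
    positive and negative parts. *)
Lemma ge0_sample_mean_cvg (h : V -> R) :
  measurable_fun setT h -> (forall u, 0 <= h u) ->
  m.-integrable setT (fun u => (h u ^+ 2)%:E) ->
  m.-integrable setT (EFin \o h) /\
  {ae P, forall w, (\sum_(i < M) h (n i w)) / M%:R @[M --> \oo] --> \int[m]_u h u}.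
Proof.
move=> mh h0 ih2.
have ih : m.-integrable setT (EFin \o h).
  have i1 : m.-integrable setT (fun u : V => (1 + (h u ^+ 2)%:E)%E).
    by apply: integrableD => //; exact: finite_measure_integrable_cst.
  apply: le_integrable i1 => //; first exact/measurable_EFinP.
  move=> u _ /=; rewrite lee_fin ger0_norm// ger0_norm ?addr_ge0 ?sqr_ge0//.
  by have := h0 u; nra.
split => //.
have mE : (\int[m]_u (h u)%:E = (\int[m]_u h u)%:E)%E.
  by rewrite /Rintegral fineK//; exact: integrable_fin_num ih.
have m2E : (\int[m]_u (h u ^+ 2)%:E = (\int[m]_u (h u ^+ 2))%:E)%E.
  by rewrite /Rintegral fineK//; exact: integrable_fin_num ih2.
have mhE : measurable_fun setT (fun u : V => (h u)%:E) by exact/measurable_EFinP.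
(* The constant [C] is the second moment of [h]: on the diagonal the bound is then immediate, and
   off it independence gives the square of the mean exactly. *)
apply: (@strong_law_nonneg _ _ _ P (fun i w => h (n i w)) _ (\int[m]_u (h u ^+ 2))) => //.
- by move=> i; apply: measurableT_comp mh _; exact: (measurable_sample P iid i).
- by move=> i; rewrite (ge0_integral_sample _ iid i (fun u => (h u)%:E)).
- by apply: Rintegral_ge0 => u _; rewrite sqr_ge0.
move=> i k; have [->|ik] := eqVneq i k.
  rewrite (ge0_integral_sample _ iid k (fun u => (h u * h u)%:E)); last 2 first.
  - by apply/measurable_EFinP; exact: measurable_funM.
  - by move=> u; rewrite lee_fin mulr_ge0.
  by rewrite -[leLHS]/(\int[m]_u (h u ^+ 2)%:E)%E m2E mul1r lee_fin lerDr sqr_ge0.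
under eq_integral do rewrite EFinM.
rewrite (ge0_integral_sample_pair _ iid i k (fun u => (h u)%:E))//.
by rewrite mul0r addr0 mE -EFinM expr2.
Qed.

Lemma sample_mean_cvg (g : V -> R) : measurable_fun setT g ->
  m.-integrable setT (fun u => (g u ^+ 2)%:E) ->
  {ae P, forall w, (\sum_(i < M) g (n i w)) / M%:R @[M --> \oo] --> \int[m]_u g u}.
Proof.
move=> mg ig2.
have part (h : V -> R) : measurable_fun setT h -> (forall u, 0 <= h u <= `|g u|) ->
    m.-integrable setT (fun u => (h u ^+ 2)%:E).
  move=> mh h0; apply: le_integrable ig2 => //.
    by apply/measurable_EFinP; exact: measurable_funX.
  move=> u _ /=; rewrite lee_fin !ger0_norm ?sqr_ge0// -[leRHS]real_normK ?num_real//.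
  by have /andP[h1 h2] := h0 u; rewrite ler_sqr ?nnegrE.
have mp : measurable_fun setT g^\+ by exact: measurable_funrpos.
have mn : measurable_fun setT g^\- by exact: measurable_funrneg.
have ip : m.-integrable setT (fun u => (g^\+ u ^+ 2)%:E).
  by apply: part => // u; rewrite funrpos_ge0 /funrpos ge_max ler_norm normr_ge0.
have iN : m.-integrable setT (fun u => (g^\- u ^+ 2)%:E).
  by apply: part => // u; rewrite funrneg_ge0 /funrneg ge_max -normrN ler_norm normr_ge0.
have [ip1 cp] := ge0_sample_mean_cvg _ mp (fun u => funrpos_ge0 g u) ip.
have [in1 cn] := ge0_sample_mean_cvg _ mn (fun u => funrneg_ge0 g u) iN.
have gE u : g u = g^\+ u - g^\- u by rewrite -[in LHS](funrposBneg g).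
have -> : \int[m]_u g u = \int[m]_u g^\+ u - \int[m]_u g^\- u.
  by rewrite -RintegralB//; apply: eq_Rintegral => u _.
apply: filterS2 cp cn => w cpw cnw.
under eq_fun do (under eq_bigr do rewrite gE; rewrite sumrB mulrBl).
exact: cvgB.
Qed.

End weighted_estimate.

(** * Limits and spans of row vectors *)

Lemma cvg_rV {R : realType} {d : nat} (f : nat -> 'rV[R]_d) (l : 'rV[R]_d) :
  (forall j, f M 0 j @[M --> \oo] --> l 0 j) -> f M @[M --> \oo] --> l.
Proof.
move=> fl A [B nB BA].
have : \forall M \near \oo, forall ij : 'I_1 * 'I_d, B ij.1 ij.2 (f M ij.1 ij.2).
  apply: filter_forall => -[i j] /=; rewrite (ord1 i); apply: fl.
  by have := nB i j; rewrite (ord1 i).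
by apply: filterS => M h; apply: BA => i j; exact: (h (i, j)).
Qed.

(** Each column of the cokernel matrix of [X] is orthogonal to all rows [x k], hence to [b]. So [b]
    is annihilated by the cokernel matrix, which places it in the row space of [X]. *)
Lemma span_of_orthogonal {R : realType} (L d : nat) (x : 'I_L -> 'rV[R]_d) (b : 'rV[R]_d) :
  (forall v, (forall k, dotv (x k) v = 0) -> dotv b v = 0) ->
  exists beta : 'I_L -> R, b = \sum_(k < L) beta k *: x k.
Proof.
move=> bx; pose X : 'M[R]_(L, d) := \matrix_k x k.
have /submxP[D bD] : (b <= X)%MS.
  rewrite submxE; apply/eqP/rowP => j; rewrite mxE.
  pose v : 'rV[R]_d := \row_i cokermx X i j.
  rewrite [RHS]mxE -[RHS](bx v).
    by apply: eq_bigr => i _; rewrite !mxE.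
  move=> k; have /matrixP/(_ k j) := mulmx_coker X; rewrite !mxE => kj.
  by rewrite -[RHS]kj; apply: eq_bigr => i _; rewrite !mxE.
exists (D 0); rewrite bD mulmx_sum_row; apply: eq_bigr => k _.
by rewrite rowK.
Qed.

(** * Almost sure limit of a weighted mean *)

Section weighted_mean_span.
Context {R : realType} {dT : measure_display} {T : measurableType dT}.
Context (P : probability T R) {L d : nat} (x : 'I_L -> 'rV[R]_d) {n : nat -> T -> 'rV[R]_d}.
Hypothesis iid : iid_std_gaussian P n.
Local Notation V := (rVbox R d).
Local Notation m := (sample_law P iid).
Variable W : V -> R.
Hypotheses (mW : measurable_fun setT W) (W01 : forall u, 0 <= W u <= 1)
  (Wx : forall u v t, (forall k, dotv (x k) v = 0) -> W (u + t *: v) = W u).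

Let gm := std_gaussian_sample_law P iid.
Let E := \int[m]_u W u.
Let b j := \int[m]_u (W u * u 0 j).

Let dotv_delta (u : V) j : dotv u (delta_mx 0 j) = u 0 j.
Proof.
rewrite /dotv (bigD1 j)//= big1 ?addr0; first by rewrite mxE !eqxx mulr1.
by move=> i /negPf ij; rewrite mxE ij andbF mulr0.
Qed.

(** By linearity the inner product of the vector [b] with v is the integral of W(u) <u, v>, which
    vanishes as soon as v is orthogonal to every [x k]. *)
Lemma weighted_mean_in_span : exists beta : 'I_L -> R,
  \row_j b j = \sum_(k < L) beta k *: x k.
Proof.
apply: span_of_orthogonal => v xv.
rewrite -[RHS](weight_dotv_eq0 m gm W mW W01 v (fun u t => Wx u v t xv)).
have iW j : m.-integrable setT (fun u : V => (W u * u 0 j)%:E).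
  have := integrable_weight_dotv m gm W mW W01 (delta_mx 0 j).
  by apply: eq_integrable => // u _; rewrite dotv_delta.
have bv j : (\int[m]_u (W u * u 0 j * v 0 j)%:E = (b j * v 0 j)%:E)%E.
  under eq_integral do rewrite EFinM.
  rewrite integralZr// EFinM; congr (_ * _)%E.
  by rewrite /b /Rintegral fineK//; exact: integrable_fin_num (iW j).
rewrite /Rintegral; under eq_integral do rewrite /dotv mulr_sumr -sumEFin.
rewrite integral_sum//; last first.
  by move=> j; under eq_fun do rewrite mulrA EFinM; exact: integrableZr.
under eq_bigr => j _ do (under eq_integral do rewrite mulrA; rewrite bv).
by rewrite sumEFin; apply: eq_bigr => j _; rewrite mxE.
Qed.

(* If [E = 0] the estimate is identically [0], because [0^-1 = 0]. *)
Lemma weight_eq0_ae : E = 0 -> {ae P, forall w, forall i, W (n i w) = 0}.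
Proof.
move=> E0; apply: ae_foralln => i.
have mWn : measurable_fun setT (fun w => (W (n i w))%:E).
  by apply/measurable_EFinP; apply: measurableT_comp mW _; exact: (measurable_sample P iid i).
have W0 u : 0 <= W u by have /andP[] := W01 u.
have : (\int[P]_w `|(W (n i w))%:E| = 0)%E.
  under eq_integral do rewrite gee0_abs ?lee_fin//.
  rewrite (ge0_integral_sample P iid i (fun u => (W u)%:E))//; last first.
    exact/measurable_EFinP.
  have := integrable_fin_num measurableT (integrable_weight m W mW W01).
  by move: E0; rewrite /E /Rintegral => + fin; rewrite -[in X in _ -> X](fineK fin) => ->.
move/(ae_eq_integral_abs P measurableT mWn); apply: filterS => w /(_ Logic.I).
by case.
Qed.

(** For nonzero [E], numerator and denominator are both divided by [M]; they converge to [b],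
    coordinate by coordinate, and to [E], so the coefficients of [b] are scaled by [E^-1]. *)
Theorem weighted_mean_cvg : exists alpha : 'I_L -> R,
  {ae P, forall w,
    (\sum_(i < M) W (n i w))^-1 *: (\sum_(i < M) W (n i w) *: n i w) @[M --> \oo] -->
    \sum_(k < L) alpha k *: x k}.
Proof.
have [E0|E0] := eqVneq E 0.
  exists (fun=> 0); apply: filterS (weight_eq0_ae E0) => w Ww.
  rewrite big1 => [|k _]; last by rewrite scale0r.
  rewrite (_ : (fun M => _) = (fun=> 0)); first exact: cvg_cst.
  by apply/funext => M; rewrite big1 => [|i _]; rewrite ?invr0 ?scale0r ?Ww.
have [beta bE] := weighted_mean_in_span.
exists (fun k => E^-1 * beta k).
have cE : {ae P, forall w, (\sum_(i < M) W (n i w)) / M%:R @[M --> \oo] --> E}.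
  apply: (sample_mean_cvg P iid) => //.
  apply: le_integrable (integrable_weight m W mW W01) => //.
    by apply/measurable_EFinP; exact: measurable_funX.
  move=> u _ /=; have /andP[h0 h1] := W01 u.
  by rewrite lee_fin !ger0_norm ?sqr_ge0// expr2 ler_piMr.
have cb : {ae P, forall w, forall j : 'I_d,
    (\sum_(i < M) W (n i w) * n i w 0 j) / M%:R @[M --> \oo] --> b j}.
  apply: filter_forall => j.
  have mj := @measurable_coord R d j.
  apply: (sample_mean_cvg P iid (fun u => W u * u 0 j)); first exact: measurable_funM.
  have := integrable_sqr_dotv m gm (delta_mx 0 j).
  apply: le_integrable => //.
    by apply/measurable_EFinP; apply: measurable_funX; exact: measurable_funM.
  move=> u _ /=; have /andP[h0 h1] := W01 u.
  rewrite dotv_delta lee_fin !ger0_norm ?sqr_ge0// exprMn ler_piMl ?sqr_ge0//.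
  by rewrite expr2 mulr_ile1.
apply: filterS2 cE cb => w cEw cbw; apply: cvg_rV => j.
have -> : \sum_(k < L) (E^-1 * beta k) *: x k = E^-1 *: \row_j b j.
  by rewrite bE scaler_sumr; apply: eq_bigr => k _; rewrite scalerA.
rewrite !mxE.
have lim := cvgM (cvgV E0 cEw) (cbw j).
rewrite (_ : (fun M => _) = (fun M => ((\sum_(i < M) W (n i w)) / M%:R)^-1 *
    ((\sum_(i < M) W (n i w) * n i w 0 j) / M%:R))); first exact: lim.
(* Cancelling [M%:R] requires it to be nonzero; for [M = 0] both sides are 0 because the sums are
   empty. *)
apply/funext => -[|M]; first by rewrite mxE summxE !big_ord0 mul0r !mulr0.
rewrite mxE summxE invfM invrK mulrACA divff ?mulr1 ?pnatr_eq0//.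
by congr (_ * _); apply: eq_bigr => i _; rewrite mxE.
Qed.

End weighted_mean_span.

(** * Invariance, measurability and bounds of the assignment weights *)

Section assignment_weights.
Context {R : realType} {L d : nat} (x : 'I_L -> 'rV[R]_d).
Local Notation V := (rVbox R d).

Lemma dotv_orthogonal_shift (u v : 'rV[R]_d) (t : R) (k : 'I_L) :
  dotv (x k) v = 0 -> dotv (u + t *: v) (x k) = dotv u (x k).
Proof.
move=> xv; have -> : dotv (u + t *: v) (x k) = dotv u (x k) + t * dotv (x k) v.
  rewrite /dotv mulr_sumr -big_split/=; apply: eq_bigr => j _.
  by rewrite !mxE; ring.
by rewrite xv mulr0 addr0.
Qed.

Lemma hard_assigned_orthogonal_shift (u v : 'rV[R]_d) (t : R) (l : 'I_L) :
  (forall k, dotv (x k) v = 0) -> hard_assigned x (u + t *: v) l = hard_assigned x u l.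
Proof.
by move=> xv; apply: eq_forallb => r; rewrite !dotv_orthogonal_shift.
Qed.

Lemma soft_weight_orthogonal_shift (u v : 'rV[R]_d) (t : R) (l : 'I_L) :
  (forall k, dotv (x k) v = 0) -> soft_weight x (u + t *: v) l = soft_weight x u l.
Proof.
move=> xv; rewrite /soft_weight dotv_orthogonal_shift//; congr (_ / _).
by apply: eq_bigr => r _; rewrite dotv_orthogonal_shift.
Qed.

(** The assignment region is a finite intersection of sets cut out by comparing two inner products,
    and the weight is its indicator. *)
Lemma measurable_hard_assigned (l : 'I_L) :
  measurable_fun setT (fun u : V => (hard_assigned x u l)%:R : R).
Proof.
have mdot k : measurable_fun setT (fun u : V => dotv u (x k)) by exact: measurable_dotv.
have mS (f : V -> bool) : measurable_fun setT f -> measurable [set u | f u].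
  by move=> mf; have := mf measurableT [set true] I; rewrite setTI.
have mA : measurable [set u : V | hard_assigned x u l].
  have -> : [set u : V | hard_assigned x u l] = \bigcap_(r in [set: 'I_L])
      ([set u : V | dotv u (x r) <= dotv u (x l)] `&`
       [set u : V | (r < l)%N ==> (dotv u (x r) < dotv u (x l))]).
    apply/seteqP; split => u /=; first by move=> /forallP h r _; apply/andP; exact: h.
    by move=> h; apply/forallP => r; apply/andP; exact: h.
  apply: fin_bigcap_measurable => // r _; apply: measurableI.
    by apply: mS; exact: measurable_fun_ler.
  apply: mS; case: (r < l)%N => /=; first exact: measurable_fun_ltr.
  exact: measurable_cst.
have -> : (fun u : V => (hard_assigned x u l)%:R : R) = \1_[set u : V | hard_assigned x u l].
  apply/funext => u; rewrite indicE; case: (boolP (hard_assigned x u l)) => h.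
    by rewrite mem_set.
  by rewrite memNset//= ; exact/negP.
exact: measurable_indic.
Qed.

Lemma measurable_soft_weight (l : 'I_L) :
  measurable_fun setT (fun u : V => soft_weight x u l).
Proof.
have mdot k : measurable_fun setT (fun u : V => expR (dotv u (x k))).
  by apply: measurableT_comp => //; exact: measurable_dotv.
have S0 u : 0 < \sum_(r < L) expR (dotv u (x r)).
  by rewrite (bigD1 l)//= ltr_wpDr ?expR_gt0// sumr_ge0// => r _; rewrite expR_ge0.
(* Inversion is not continuous at [0]; [expR \o -%R \o ln] agrees with it on
   positive reals. *)
rewrite (_ : (fun u => _) = (fun u : V =>
    expR (dotv u (x l)) * expR (- ln (\sum_(r < L) expR (dotv u (x r)))))); last first.
  by apply/funext => u; rewrite expRN lnK ?posrE.
apply: measurable_funM => //; apply: measurableT_comp => //.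
apply: measurableT_comp => //; apply: measurableT_comp => //.
exact: measurable_sum.
Qed.

Lemma soft_weight_ge0_le1 (u : 'rV[R]_d) (l : 'I_L) : 0 <= soft_weight x u l <= 1.
Proof.
have S0 : 0 < \sum_(r < L) expR (dotv u (x r)).
  by rewrite (bigD1 l)//= ltr_wpDr ?expR_gt0// sumr_ge0// => r _; rewrite expR_ge0.
rewrite /soft_weight; apply/andP; split.
  by rewrite divr_ge0 ?expR_ge0// ltW.
rewrite ler_pdivrMr// mul1r.
by rewrite (bigD1 l)//= lerDl sumr_ge0// => r _; rewrite expR_ge0.
Qed.

End assignment_weights.

(** * Convergence of the two estimators *)

Theorem theorem4 (R : realType) (dT : measure_display) (T : measurableType dT)
  (P : probability T R) (L d : nat) (x : 'I_L -> 'rV[R]_d)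
  (n : nat -> T -> 'rV[R]_d) :
  (2 <= L)%N -> (1 <= d)%N ->
  injective x ->
  (forall k l : 'I_L, enorm (x k) = enorm (x l)) ->
  iid_std_gaussian P n ->
  (forall l : 'I_L, exists alpha : 'I_L -> R,
     {ae P, forall w, hard_estimate x (fun i => n i w) M l @[M --> \oo] -->
                        \sum_(k < L) alpha k *: x k}) /\
  (forall l : 'I_L, exists alpha : 'I_L -> R,
     {ae P, forall w, soft_estimate x (fun i => n i w) M l @[M --> \oo] -->
                        \sum_(k < L) alpha k *: x k}).
Proof.
move=> _ _ _ _ iid; split => l.
  (* With the indicator of the assignment region as weight, the sums over assigned samples become
     weighted sums over all samples. *)
  pose W (u : rVbox R d) : R := (hard_assigned x u l)%:R.
  have estE w : (fun M => hard_estimate x (fun i => n i w) M l) =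
      (fun M => (\sum_(i < M) W (n i w))^-1 *: (\sum_(i < M) W (n i w) *: n i w)).
    apply/funext => M; rewrite /hard_estimate; congr (_^-1 *: _); rewrite [LHS]big_mkcond/=.
      by apply: eq_bigr => i _; rewrite /W; case: ifP.
    by apply: eq_bigr => i _; rewrite /W; case: ifP => _; rewrite ?scale1r ?scale0r.
  have [|u|u v t xv|alpha h] := @weighted_mean_cvg _ _ _ P L d x n iid W.
  - exact: measurable_hard_assigned.
  - by rewrite /W; case: (hard_assigned x u l); rewrite ?lexx ?ler01.
  - by rewrite /W hard_assigned_orthogonal_shift.
  by exists alpha; apply: filterS h => w; rewrite estE.
apply: (@weighted_mean_cvg _ _ _ P L d x n iid (fun u => soft_weight x u l)).
- exact: measurable_soft_weight.
- by move=> u; exact: soft_weight_ge0_le1.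
- by move=> u v t xv; exact: soft_weight_orthogonal_shift.
Qed.
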